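(* Let $d\ge 16$ be even and let $k=\lfloor d/4\rfloor$. Then $\chi_{CF}(\mathsf{FC}_d(n))=O(n^{1-\frac{2}{3k-1+\epsilon}})$ as $n\to\infty$, where $\epsilon=0$ if $k$ is odd and $\epsilon=1$ if $k$ is even.
   Context: A hypergraph is a pair $(V,\mathcal{E})$ with $\mathcal{E}\subseteq 2^V$. A conflict-free coloring (CF-coloring) of a hypergraph is a map $\varphi$ on $V$ such that every nonempty hyperedge $e$ contains a vertex $x$ with $\varphi(y)\ne\varphi(x)$ for all $y\in e\setminus\{x\}$; $\chi_{CF}(H)$ is the least number of colors in a CF-coloring of $H$. For $n\ge d+1$, $\mathsf{C}_d(n)$ is the convex hull of $\gamma_d(1),\dots,\gamma_d(n)$ where $\gamma_d(t)=(t,t^2,\dots,t^d)$, and we identify $\gamma_d(i)$ with $i\in[n]$. $\mathsf{FC}_d(n)$ is the $d$-uniform hypergraph on $[n]$ whose hyperedges are the vertex sets of facets of $\mathsf{C}_d(n)$. Equivalently (Gale's evenness criterion), a $d$-subset $S\subseteq[n]$ is a hyperedge iff for all $i,j\in[n]\setminus S$ the set $\{k\in S: i<k<j\}$ has even size. *)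

(* Defs.v *)
From HB Require Import structures.
From mathcomp Require Import all_boot all_order all_algebra.
From mathcomp Require Import all_classical all_reals all_analysis.

Set Implicit Arguments.
Unset Strict Implicit.
Unset Printing Implicit Defensive.

Import Order.TTheory GRing.Theory Num.Theory.
Import numFieldNormedType.Exports.

Local Open Scope classical_set_scope.
Local Open Scope ring_scope.

(* A hypergraph on the finite vertex type [V] is given by its set of
   hyperedges. *)
Definition hypergraph (V : finType) := {set {set V}}.

Definition conflict_free (V : finType) (C : eqType) (H : hypergraph V)
    (phi : V -> C) : bool :=
  [forall e in H, (e != finset.set0) ==>
    [exists x in e, [forall y in (e :\ x)%SET, phi y != phi x]]].

Definition cf_colorable (V : finType) (H : hypergraph V) (c : nat) : bool :=
  [exists phi : {ffun V -> 'I_c}, conflict_free H phi].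

Lemma cf_colorable_ex (V : finType) (H : hypergraph V) :
  exists c, cf_colorable H c.
Proof.
exists #|V|; apply/existsP; exists [ffun x => enum_rank x].
apply/forall_inP => e _; apply/implyP => /finset.set0Pn[x xe].
apply/exists_inP; exists x => //; apply/forall_inP => y.
by rewrite !inE !ffunE (inj_eq enum_rank_inj) => /andP[].
Qed.

Definition chi_cf (V : finType) (H : hypergraph V) : nat :=
  ex_minn (cf_colorable_ex H).

Definition convex_hull (R : realType) (E : lmodType R) (A : set E) : set E :=
  smallest (@convex_set R E) A.

(* The zero functional is allowed, so a nonempty [P] is a face of itself; the
   empty face is allowed as well.  Neither is a facet, by dimension. *)
Definition face (R : realType) (E : lmodType R) (P F : set E) : Prop :=
  exists (f : {scalar E}) (c : R),
    (forall x, P x -> f x <= c) /\ F = [set x | P x /\ f x = c].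

Definition affinely_independent (R : realType) (E : lmodType R) (m : nat)
    (x : 'I_m -> E) : Prop :=
  forall w : 'I_m -> R, \sum_i w i = 0 -> \sum_i w i *: x i = 0 ->
    forall i, w i = 0.

(* The affine dimension of [A] is the natural number [m]: at most, and for some
   choice, m + 1 points of [A] are affinely independent.  The empty set has no
   dimension in this sense. *)
Definition affine_dim (R : realType) (E : lmodType R) (A : set E) (m : nat) :
    Prop :=
  (exists x : 'I_m.+1 -> E, (forall i, A (x i)) /\ affinely_independent x) /\
  ~ (exists x : 'I_m.+2 -> E, (forall i, A (x i)) /\ affinely_independent x).

Definition facet (R : realType) (E : lmodType R) (P F : set E) : Prop :=
  face P F /\ exists m, affine_dim P m.+1 /\ affine_dim F m.

Definition vertices (R : realType) (E : lmodType R) (P : set E) : set E :=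
  [set x | face P [set x]].

Definition moment_curve (R : realType) (d : nat) (t : R) : 'rV[R]_d :=
  \row_(j < d) t ^+ j.+1.

(* The element [i] of ['I_n], i.e. i in {0, ..., n - 1}, stands for the element
   i + 1 of {1, ..., n}. *)
Definition cyclic_point (R : realType) (d n : nat) (i : 'I_n) : 'rV[R]_d :=
  moment_curve d (i.+1)%:R.

Definition cyclic_polytope (R : realType) (d n : nat) : set 'rV[R]_d :=
  convex_hull (range (@cyclic_point R d n)).

Definition FC (R : realType) (d n : nat) : hypergraph 'I_n :=
  [set S : {set 'I_n} | `[< exists F : set 'rV[R]_d,
      facet (@cyclic_polytope R d n) F /\
      @cyclic_point R d n @` [set` S] = vertices F >]]%SET.

(* Main.v *)
(* A facet of the cyclic polytope C_d(n) avoiding the vertex n is a union of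
   d/2 disjoint pairs {i, i+1}. If the vertices 1, ..., n-1 are coloured by
   a walk in a graph G that uses no edge twice, such a facet becomes a set
   of d/2 edges of G, and if no colour is unique in it this subgraph has
   minimum degree 2, hence contains a cycle of length at most d/2. So it
   suffices to find a dense bipartite graph without cycles of length at most
   2k, as d/2 <= 2k + 1; the edges of any graph split into at most |V(G)|
   trails, and separating these by unique colours costs O(|V(G)|) further
   colours, so that no Eulerian circuit is needed.

   The graph is a coset graph: U is a finite quotient of the unipotent group
   of matrices in SL_2(F_q[t]) congruent to an upper unitriangular matrix
   modulo t, the edges are the elements of U, and the two classes of
   vertices are the cosets of the subgroups {[1, a; 0, 1]} and {[1, 0; b t,
   1]}. A cycle of length 2g <= 2k is an equality in U between two
   alternating words of length g starting in different subgroups; already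
   the first columns of such words have different degrees in t, and the
   quotient U keeps just enough coefficients to see this: |U| = q^L with 2L
   = 3k - 1 + eps, against 2 q^(L-1) vertices. *)

Require Import Defs.
From HB Require Import structures.
From mathcomp Require Import all_boot all_order all_algebra all_field.
From mathcomp Require Import ring zify lra.

Set Implicit Arguments.
Unset Strict Implicit.
Unset Printing Implicit Defensive.

Import Order.TTheory GRing.Theory Num.Theory.

Local Open Scope ring_scope.

(** * A bipartite graph of large girth *)

Lemma dvdXnP (F : fieldType) (N : nat) (p : {poly F}) :
  reflect (forall i, (i < N)%N -> p`_i = 0) ('X^N %| p).
Proof.
apply: (iffP (Pdiv.Field.dvdpP _ _)) => [[q ->] i iN|p0].
  by rewrite coefMXn iN.
exists (drop_poly N p); rewrite -[LHS](poly_take_drop N).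
suff -> : take_poly N p = 0 by rewrite add0r.
by apply/polyP => i; rewrite coef_take_poly coef0; case: ifP => // /p0.
Qed.

Lemma dvdXn_cancel (F : fieldType) (N : nat) (p q : {poly F}) :
  q`_0 != 0 -> 'X^N %| q * p -> 'X^N %| p.
Proof.
move=> q0; rewrite Gauss_dvdpr //.
by rewrite coprimep_expl // coprimep_sym coprimepX rootE horner_coef0.
Qed.

Lemma dvdXn_le (F : fieldType) (M N : nat) (p : {poly F}) :
  (N <= M)%N -> 'X^M %| p -> 'X^N %| p.
Proof. by move=> NM; apply: dvdp_trans; rewrite dvdp_exp2l. Qed.

Lemma poly_rV_drop_eq (F : fieldType) (m N : nat) (p q : {poly F}) :
  poly_rV (drop_poly N p) = poly_rV (drop_poly N q) :> 'rV[F]_m ->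
  forall i, (N <= i < N + m)%N -> p`_i = q`_i.
Proof.
move=> /rowP pq i /andP[Ni iNm].
have im : (i - N < m)%N by lia.
by have := pq (Ordinal im); rewrite !mxE !coef_drop_poly /= subnK.
Qed.

Lemma rVpoly_eq (F : fieldType) (m : nat) (u v : 'rV[F]_m) :
  'X^m %| rVpoly u - rVpoly v -> u = v.
Proof.
move=> /dvdXnP uv; apply/rowP => i; have := uv i (ltn_ord i).
by rewrite coefB !coef_rVpoly_ord => /eqP; rewrite subr_eq0 => /eqP.
Qed.

Section UnipotentGraph.
Variables (F : finFieldType) (h o : nat).

(** Only free coefficients are stored: degrees 1 to [h] of the upper left entry, below [h] of the
    upper right one, 1 to [h + o] of the lower left one. In the application [h.*2 + o] is [k]. *)
Definition unip := ('rV[F]_h * 'rV[F]_h * 'rV[F]_(h + o))%type.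
Definition point_coset := ('rV[F]_h * 'rV[F]_(h + o) * 'rV[F]_h.-1)%type.
Definition line_coset := ('rV[F]_h * 'rV[F]_h * 'rV[F]_(h + o).-1)%type.

Implicit Types u v : unip.

Definition entry11 u : {poly F} := 1 + rVpoly u.1.1 * 'X.
Definition entry12 u : {poly F} := rVpoly u.1.2.
Definition entry21 u : {poly F} := rVpoly u.2 * 'X.
(* The geometric sum inverts [entry11 u] modulo 'X^(h.+1), so that the
   determinant is 1 modulo 'X^(h.+1). *)
Definition entry22 u : {poly F} :=
  (1 + entry12 u * entry21 u) * \sum_(i < h.+1) (1 - entry11 u) ^+ i.

(** Right multiplication by [[1, a; 0, 1]] adds [a] times the first column to the second;
    normalising the constant term of [entry12] to 0 removes the dependence on [a]. *)
Definition point_of u : point_coset :=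
  (u.1.1, u.2, poly_rV (drop_poly 1 (entry12 u - (entry12 u)`_0 *: entry11 u))).
(** Here a multiple of ['X] times the second column is added to the first, and the coefficient of
    degree 1 in [entry21] is normalised. The determinant recovers [entry11]. *)
Definition line_of u : line_coset :=
  (u.1.2, poly_rV (drop_poly 1 (entry22 u)),
   poly_rV (drop_poly 2 (entry21 u - (entry21 u)`_1 *: ('X * entry22 u)))).

Lemma entry11_0 u : (entry11 u)`_0 = 1.
Proof. by rewrite coefD coefMX addr0 coef1. Qed.

Lemma entry21_0 u : (entry21 u)`_0 = 0.
Proof. by rewrite coefMX. Qed.

Lemma det_unip u :
  'X^(h.+1) %| entry11 u * entry22 u - (1 + entry12 u * entry21 u).
Proof.
rewrite /entry22; set s := \sum_(i < _) _.
have -> : entry11 u * ((1 + entry12 u * entry21 u) * s) -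
    (1 + entry12 u * entry21 u) =
    - (1 + entry12 u * entry21 u) * (1 - entry11 u) ^+ h.+1.
  have E : (1 - entry11 u) ^+ h.+1 = 1 - entry11 u * s.
    have := subrX1 (1 - entry11 u) h.+1; rewrite -/s => /eqP; rewrite subr_eq.
    by move=> /eqP ->; ring.
  by rewrite E; ring.
apply: dvdp_mull; apply: dvdp_exp2r.
by rewrite /entry11 opprD addrA subrr add0r dvdpNr dvdp_mull.
Qed.

Lemma entry22_0 u : (entry22 u)`_0 = 1.
Proof.
have /dvdXnP/(_ 0 isT) := det_unip u.
rewrite coefB coefD (coef0M (entry11 u)) (coef0M (entry12 u)) entry11_0 entry21_0.
rewrite mul1r mulr0 addr0 coef1.
by move/eqP; rewrite subr_eq0 => /eqP.
Qed.

Hypothesis h_gt0 : (0 < h)%N.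
Hypothesis o_le1 : (o <= 1)%N.

(** The determinant congruence is solved for [entry22]. The error modulo ['X^h] in [entry12] gets
    multiplied by [entry21], whose factor ['X] gains the missing power. *)
Lemma entry22_transfer u v (b : {poly F}) :
  entry11 v = entry11 u -> entry21 v = entry21 u ->
  'X^h %| entry12 v - (entry12 u + b * entry11 u) ->
  'X^(h.+1) %| entry22 v - (entry22 u + b * entry21 u).
Proof.
move=> E11 E21 E12; apply: (@dvdXn_cancel _ _ _ (entry11 u)).
  by rewrite entry11_0 oner_eq0.
have -> : entry11 u * (entry22 v - (entry22 u + b * entry21 u)) =
  (entry11 v * entry22 v - (1 + entry12 v * entry21 v))
  - (entry11 u * entry22 u - (1 + entry12 u * entry21 u))
  + (entry12 v - (entry12 u + b * entry11 u)) * rVpoly u.2 * 'X.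
  by rewrite E11 E21 /entry21; ring.
apply: dvdp_add; first by apply: dvdp_sub; apply: det_unip.
by rewrite exprSr dvdp_mul // dvdp_mulr.
Qed.

Lemma entry11_transfer u v (c : {poly F}) :
  entry12 v = entry12 u -> 'X^(h.+1) %| entry22 v - entry22 u ->
  'X^(h.+1) %| entry21 v - (entry21 u + c * entry22 u) ->
  'X^(h.+1) %| entry11 v - (entry11 u + c * entry12 u).
Proof.
move=> E12 E22 E21; apply: (@dvdXn_cancel _ _ _ (entry22 u)).
  by rewrite entry22_0 oner_eq0.
have -> : entry22 u * (entry11 v - (entry11 u + c * entry12 u)) =
  (entry11 v * entry22 v - (1 + entry12 v * entry21 v))
  - (entry11 u * entry22 u - (1 + entry12 u * entry21 u))
  + (entry12 u * (entry21 v - (entry21 u + c * entry22 u))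
     - entry11 v * (entry22 v - entry22 u)).
  by rewrite E12; ring.
apply: dvdp_add; first by apply: dvdp_sub; apply: det_unip.
by apply: dvdp_sub; apply: dvdp_mull.
Qed.

(** Up to truncation, [v] is [u] times [[1, a; 0, 1]]. Testing on vectors with ['X %| y] makes up
    for the lower precision of the second column. *)
Lemma point_step u v : point_of u = point_of v -> u != v ->
  exists2 a : F, a != 0 & forall x y : {poly F}, 'X %| y ->
   'X^(h.+1) %| (entry11 v * x + entry12 v * y)
              - (entry11 u * (x + a *: y) + entry12 u * y) /\
   'X^((h + o).+1) %| (entry21 v * x + entry22 v * y)
              - (entry21 u * (x + a *: y) + entry22 u * y).
Proof.
case=> A C /poly_rV_drop_eq B uv.
have E11 : entry11 v = entry11 u by rewrite /entry11 A.
have E21 : entry21 v = entry21 u by rewrite /entry21 C.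
(* This constant term is the only coordinate that [point_of] loses, so [a = 0] would force
   [u = v]. *)
pose a := (entry12 v)`_0 - (entry12 u)`_0; exists a.
  apply: contraNneq uv => a0; apply/eqP.
  suff B' : u.1.2 = v.1.2.
    by rewrite [u]surjective_pairing [v]surjective_pairing [u.1]surjective_pairing
      [v.1]surjective_pairing A B' C.
  apply: rVpoly_eq; apply/dvdXnP => -[|i] ih; rewrite coefB.
    by apply/eqP; rewrite -oppr_eq0 opprB; apply/eqP.
  have := B i.+1; rewrite add1n prednK // => /(_ ih).
  rewrite !coefB !coefZ E11.
  have /eqP := a0; rewrite /a subr_eq0 => /eqP ->.
  by rewrite /entry12 => /addIr ->; rewrite subrr.
have E12 : 'X^h %| entry12 v - (entry12 u + a%:P * entry11 u).
  apply/dvdXnP => -[|i] ih.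
    rewrite coefB coefD coefCM entry11_0 mulr1 /a; ring.
  have := B i.+1; rewrite add1n prednK // => /(_ ih).
  rewrite !coefB !coefZ (coefD (entry12 u)) coefCM E11 /a => /eqP.
  by rewrite -subr_eq0 => /eqP E; rewrite -[RHS]oppr0 -[in RHS]E; ring.
have E22 := entry22_transfer E11 E21 E12.
move=> x y Xy; split.
  have -> : entry11 v * x + entry12 v * y
      - (entry11 u * (x + a *: y) + entry12 u * y) =
      (entry12 v - (entry12 u + a%:P * entry11 u)) * y.
    by rewrite E11 -mul_polyC; ring.
  by rewrite exprSr dvdp_mul.
have -> : entry21 v * x + entry22 v * y
    - (entry21 u * (x + a *: y) + entry22 u * y) =
    (entry22 v - (entry22 u + a%:P * entry21 u)) * y.
  by rewrite E21 -mul_polyC; ring.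
apply: (@dvdXn_le _ h.+2); first by lia.
by rewrite exprSr dvdp_mul.
Qed.

Lemma line_step u v : line_of u = line_of v -> u != v ->
  exists2 c : F, c != 0 & forall x y : {poly F}, 'X %| y ->
   'X^(h.+1) %| (entry11 v * x + entry12 v * y)
              - (entry11 u * x + entry12 u * (y + c *: (x * 'X))) /\
   'X^((h + o).+1) %| (entry21 v * x + entry22 v * y)
              - (entry21 u * x + entry22 u * (y + c *: (x * 'X))).
Proof.
case=> B /poly_rV_drop_eq D /poly_rV_drop_eq C uv.
have E12 : entry12 v = entry12 u by rewrite /entry12 B.
have E22 : 'X^(h.+1) %| entry22 v - entry22 u.
  apply/dvdXnP => -[|i] ih; rewrite coefB ?entry22_0 ?subrr //.
  by rewrite D ?subrr // add1n.
pose c := (entry21 v)`_1 - (entry21 u)`_1.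
have E21 : 'X^((h + o).+1) %| entry21 v - (entry21 u + c%:P * 'X * entry22 u).
  apply/dvdXnP => -[|[|i]] ih.
  - by rewrite coefB coefD -mulrA coefCM coefXM !entry21_0 mulr0 !addr0 subrr.
  - rewrite coefB coefD -mulrA coefCM coefXM /= entry22_0 mulr1 /c; ring.
  (* [entry22] is compared up to degree [h]; after the factor ['X] this reaches degree [h + o]
     because [o <= 1]. *)
  - have := C i.+2; rewrite add2n prednK ?addn_gt0 ?h_gt0 // => /(_ ih).
    rewrite !coefB !coefZ !coefD -mulrA !coefCM !coefXM /= D; last by lia.
    move=> /eqP; rewrite -subr_eq0 => /eqP E.
    by rewrite /c -[RHS]oppr0 -[in RHS]E; ring.
have E11 : 'X^(h.+1) %| entry11 v - (entry11 u + c%:P * 'X * entry12 u).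
  apply: entry11_transfer => //; apply: dvdXn_le E21; lia.
exists c.
  apply: contraNneq uv => c0; apply/eqP.
  move: E21 E11; rewrite c0 !mul0r !addr0 => E21 E11.
  have A' : v.1.1 = u.1.1.
    apply: rVpoly_eq; rewrite -(@dvdp_mul2r _ 'X) ?polyX_eq0 // -exprSr.
    by move: E11; rewrite /entry11 mulrBl opprD addrACA subrr add0r.
  have C' : v.2 = u.2.
    apply: rVpoly_eq; rewrite -(@dvdp_mul2r _ 'X) ?polyX_eq0 // -exprSr.
    by rewrite mulrBl.
  by rewrite [u]surjective_pairing [v]surjective_pairing [u.1]surjective_pairing
      [v.1]surjective_pairing A' B C'.
move=> x y Xy; split.
  have -> : entry11 v * x + entry12 v * y
      - (entry11 u * x + entry12 u * (y + c *: (x * 'X))) =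
      (entry11 v - (entry11 u + c%:P * 'X * entry12 u)) * x.
    by rewrite E12 -mul_polyC; ring.
  exact: dvdp_mulr.
have -> : entry21 v * x + entry22 v * y
    - (entry21 u * x + entry22 u * (y + c *: (x * 'X))) =
    (entry21 v - (entry21 u + c%:P * 'X * entry22 u)) * x
    + (entry22 v - entry22 u) * y.
  by rewrite -mul_polyC; ring.
apply: dvdp_add; first exact: dvdp_mulr.
apply: (@dvdXn_le _ h.+2); first by lia.
by rewrite exprSr dvdp_mul.
Qed.

Lemma point_line_inj : injective (fun u => (point_of u, line_of u)).
Proof.
move=> u v [A C _ B _ _].
by rewrite [u]surjective_pairing [v]surjective_pairing [u.1]surjective_pairing
      [v.1]surjective_pairing A B C.
Qed.

(** Walks are recorded through their edges: [b] tells whether consecutive edges meet in a point or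
    in a line. *)
Definition adjacent (b : bool) u v :=
  (if b then point_of u == point_of v else line_of u == line_of v) && (u != v).

Definition walk (b : bool) (g : nat) (f : nat -> unip) :=
  forall i, (i < g)%N -> adjacent (b (+) odd i) (f i) (f i.+1).

(* [(x, y)] is the first column of the product of the alternating elementary
   matrices read along the walk. *)
Lemma walk_column g b f : walk b g f ->
  exists x y : {poly F}, [/\ 'X %| y,
   'X^(h.+1) %| entry11 (f g) - (entry11 (f 0) * x + entry12 (f 0) * y),
   'X^((h + o).+1) %| entry21 (f g) - (entry21 (f 0) * x + entry22 (f 0) * y) &
   if b then size x = g./2.+1 /\ (size y <= g./2.+1)%N
   else if g is 0 then x = 1 /\ y = 0
   else (size x <= uphalf g)%N /\ size y = (uphalf g).+1].
Proof.
elim: g b f => [|g IH] b f W.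
  exists 1, 0; rewrite !mulr1 !mulr0 !addr0 !subrr !dvdp0; split=> //.
  by case: b W => //; rewrite size_poly1 size_poly0.
have /IH[x [y [Xy G1 G2 S]]] : walk (~~ b) g (fun i => f i.+1).
  by move=> i ig; have := W i.+1 ig; rewrite /= addNb addbN.
have := W 0 isT; rewrite /= addbF => /andP[].
case: b {W IH} S => [] S /eqP fE fN.
  have [a a0 /(_ x y Xy)[H1 H2]] := point_step fE fN.
  exists (x + a *: y), y; split=> //.
  - by have := dvdp_add G1 H1; rewrite addrA subrK.
  - by have := dvdp_add G2 H2; rewrite addrA subrK.
  (* A nonempty tail starting with a line step has its larger degree in [y], so the leading term of
     [a *: y] survives; in the other case below, that of [x * 'X] does. *)
  case: g G1 G2 S => [_ _ [-> ->]|g _ _ [Sx Sy]].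
    by rewrite scaler0 addr0 size_poly1 size_poly0.
  split; last by rewrite Sy; lia.
  rewrite addrC size_polyDl size_scale // Sy; lia.
have [c c0 /(_ x y Xy)[H1 H2]] := line_step fE fN.
exists x, (y + c *: (x * 'X)); split=> //.
- by rewrite dvdp_add // dvdpZr // dvdp_mull.
- by have := dvdp_add G1 H1; rewrite addrA subrK.
- by have := dvdp_add G2 H2; rewrite addrA subrK.
have [Sx Sy] := S; rewrite /= Sx; split; first by lia.
have Sx' : size (c *: (x * 'X)) = g./2.+2.
  by rewrite size_scale // size_mulX ?Sx // -size_poly_gt0 Sx.
by rewrite addrC size_polyDl Sx' //; lia.
Qed.

(** If the ends agreed, the invertible matrix of the common start would kill the difference of the
    two columns up to truncation. But this difference has a component of known degree, [y] for odd
    [g] and [x] for even [g], too small for the divisibility. *)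
Lemma walks_apart g f1 f2 : (0 < g <= h.*2 + o)%N ->
  walk true g f1 -> walk false g f2 -> f1 0%N = f2 0%N -> f1 g != f2 g.
Proof.
move=> /andP[g0 gk] /walk_column[x1 [y1 [_ A1 C1 [Sx1 Sy1]]]].
move=> /walk_column[x2 [y2 [_ A2 C2 S2]]] f0; apply/eqP => fg.
have {S2} [Sx2 Sy2] : (size x2 <= uphalf g)%N /\ size y2 = (uphalf g).+1.
  by case: (g) g0 S2.
move: A2 C2; rewrite -f0 -fg => A2 C2; set u := f1 0%N in A1 A2 C1 C2.
have R1 : 'X^(h.+1) %| entry11 u * (x1 - x2) + entry12 u * (y1 - y2).
  by have := dvdp_sub A2 A1; rewrite opprB addrC addrA subrK => E;
    move: E; congr (_ %| _); ring.
have R2 : 'X^((h + o).+1) %| entry21 u * (x1 - x2) + entry22 u * (y1 - y2).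
  by have := dvdp_sub C2 C1; congr (_ %| _); ring.
pose D := entry11 u * entry22 u - entry12 u * entry21 u.
have D0 : D`_0 != 0.
  rewrite coefB (coef0M (entry11 u)) (coef0M (entry12 u)) entry11_0.
  rewrite entry22_0 entry21_0 mulr0 subr0 mulr1.
  exact: oner_neq0.
have [Eg|Og] := boolP (odd g).
  have : 'X^((h + o).+1) %| y1 - y2.
    apply: (dvdXn_cancel D0).
    (* The first row is known modulo ['X^(h.+1)] only; the factor ['X] of [entry21] lifts it to the
       precision of the second row. *)
    have -> : D * (y1 - y2) =
        entry11 u * (entry21 u * (x1 - x2) + entry22 u * (y1 - y2))
        - rVpoly u.2 *
          ((entry11 u * (x1 - x2) + entry12 u * (y1 - y2)) * 'X).
      by rewrite /D /entry21; ring.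
    apply: dvdp_sub; first exact: dvdp_mull.
    apply: dvdp_mull; apply: (@dvdXn_le _ h.+2); first by lia.
    by rewrite exprSr dvdp_mul2r ?polyX_eq0.
  have S : size (y1 - y2) = (uphalf g).+1.
    by rewrite addrC size_polyDl size_polyN Sy2 //; lia.
  move=> /dvdp_leq; rewrite -size_poly_eq0 S size_polyXn => /(_ isT); lia.
have : 'X^(h.+1) %| x1 - x2.
  apply: (dvdXn_cancel D0).
  have -> : D * (x1 - x2) =
      entry22 u * (entry11 u * (x1 - x2) + entry12 u * (y1 - y2))
      - entry12 u * (entry21 u * (x1 - x2) + entry22 u * (y1 - y2)).
    by rewrite /D; ring.
  apply: dvdp_sub; first exact: dvdp_mull.
  apply: dvdp_mull; apply: dvdXn_le R2; lia.
have S : size (x1 - x2) = g./2.+1.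
  by rewrite size_polyDl ?Sx1 // size_polyN (leq_ltn_trans Sx2) // uphalf_half (negPf Og).
move=> /dvdp_leq; rewrite -size_poly_eq0 S size_polyXn => /(_ isT); lia.
Qed.

(** * Closed walks in the coset graph *)

Lemma adjacent_sym b u v : adjacent b u v = adjacent b v u.
Proof.
by rewrite /adjacent [v == u]eq_sym [point_of v == _]eq_sym [line_of v == _]eq_sym.
Qed.

(** The first half of a closed walk and the reversed second half start on different sides and have
    the same two ends. *)
Lemma walk_even_open g b f : (0 < g <= h.*2 + o)%N -> walk b g.*2 f -> f g.*2 != f 0%N.
Proof.
move=> gk W; apply/eqP => E.
have W1 : walk b g f by move=> i ig; apply: W; lia.
have W2 : walk (~~ b) g (fun i => f (g.*2 - i)%N).
  move=> i ig; have := W (g.*2 - i.+1)%N; rewrite adjacent_sym.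
  have -> : (g.*2 - i.+1).+1 = (g.*2 - i)%N by lia.
  have -> : b (+) odd (g.*2 - i.+1) = ~~ b (+) odd i.
    by rewrite oddB /= ?odd_double ?addFb ?addbN ?addNb //; lia.
  by apply; lia.
have E0 : f 0%N = f (g.*2 - 0)%N by rewrite subn0 E.
have Eg : f g = f (g.*2 - g)%N by congr f; lia.
case: b W1 W2 {W} => W1 W2.
  by have := walks_apart gk W1 W2 E0; rewrite -Eg eqxx.
by have := walks_apart gk W2 W1 (esym E0); rewrite -Eg eqxx.
Qed.

(* An odd closed walk has its first and last steps on the same side, so it
   can be shortened by one or two steps. *)
Lemma walk_open r b f : (0 < r <= (h.*2 + o).*2.+1)%N -> walk b r f -> f r != f 0%N.
Proof.
elim/ltn_ind: r b f => r IH b f r_bd W.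
have [Or|Er] := boolP (odd r); last first.
  have Dr : r = r./2.*2 by lia.
  by rewrite Dr; apply: (@walk_even_open _ b); rewrite -?Dr //; lia.
case: r => [|[|r]] // in r_bd IH W Or *.
  by have := W 0 isT; rewrite eq_sym => /andP[].
case: r => // r in r_bd IH W Or *.
apply/eqP => E.
have W1 : walk (~~ b) r.+1 (fun i => f i.+1).
  by move=> i ir; have := W i.+1; rewrite /= addNb addbN; apply; lia.
have := W r.+2; rewrite E ltnS leqnn => /(_ isT).
have := W 0 isT; rewrite addbF.
have -> : b (+) odd r.+2 = b by move: Or => /= /negPn/negPf->; rewrite addbF.
move=> A0 Ar.
have [E'|N'] := eqVneq (f r.+2) (f 1%N).
  have := IH r.+1 _ (~~ b) (fun i => f i.+1) _ W1; rewrite E' eqxx.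
  by move=> /(_ _ _)/negP; apply; lia.
(* The edges [f r.+2] and [f 1] both meet [f 0] on the same side, so they are adjacent and close up
   an even walk. *)
pose f' i := if (i < r.+2)%N then f i.+1 else f 1%N.
have W' : walk (~~ b) r.+2 f'.
  move=> i ir; rewrite /f' ir; have [ir'|ri] := ltnP i.+1 r.+2.
    by have := W1 i; apply; lia.
  have {ri ir} -> : i = r.+1 by lia.
  have -> : ~~ b (+) odd r.+1 = b.
    by move: Or => /=; rewrite !negbK => ->; case: (b).
  move: A0 Ar; rewrite /adjacent N' andbT => /andP[+ _] /andP[+ _].
  by case: (b) => /eqP <- /eqP ->.
have Dr : r.+2 = (r.+2)./2.*2 by move: Or; rewrite /=; lia.
have := @walk_even_open (r.+2)./2 (~~ b) f'; rewrite -Dr => /(_ _ W').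
by rewrite /f' ltnn eqxx => /(_ _)/negP; apply; lia.
Qed.

End UnipotentGraph.

(** An alternating walk inside [B] never gets stuck and, by pigeonhole, repeats an edge within
    [#|B|] steps; [walk_open] excludes short closed walks. *)
Lemma min_degree_card (F : finFieldType) (h o : nat) (B : {set unip F h o}) :
  (0 < h)%N -> (o <= 1)%N -> B != set0 ->
  (forall u, u \in B -> forall b, exists2 v, v \in B & adjacent b u v) ->
  ((h.*2 + o).*2.+1 < #|B|)%N.
Proof.
move=> h0 o1 /set0Pn[u0 u0B] deg; rewrite ltnNge; apply/negP => cardB.
pose next b u := odflt u0 [pick v in B | adjacent b u v].
have nextP b u : u \in B -> next b u \in B /\ adjacent b u (next b u).
  move=> uB; rewrite /next; case: pickP => [v /andP[]//|noB].
  by have [v vB uv] := deg u uB b; have := noB v; rewrite vB uv.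
pose c := fix c i := if i is j.+1 then next (odd j) (c j) else u0.
have cB i : c i \in B by elim: i => //= i /(nextP (odd i))[].
have cP i : adjacent (odd i) (c i) (c i.+1) by case: (nextP (odd i) _ (cB i)).
have /injectivePn[i [j ij]] : ~~ injectiveb (fun i : 'I_#|B|.+1 => c i).
  apply/injectiveP => c_inj; have := card_imset predT c_inj.
  rewrite card_ord => cE; have /negP[] := negbT (ltnn #|B|).
  rewrite -[X in (X <= _)%N]cE.
  by apply: subset_leq_card; apply/subsetP => _ /imsetP[i _ ->].
wlog ij' : i j {ij} / (i < j)%N.
  move=> W; case: (ltngtP i j) => [|ji|/val_inj E]; first exact: W.
    by move=> /esym; apply: W.
  by rewrite E eqxx in ij.
move=> cij; have jB := ltn_ord j.
have : c (i + (j - i))%N != c (i + 0)%N.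
  apply: (@walk_open _ _ _ h0 o1 (j - i) (odd i) (fun l => c (i + l)%N)).
    by lia.
  by move=> l _; rewrite addnS -oddD.
by rewrite addn0 subnKC ?cij ?eqxx // ltnW.
Qed.

(** * Decomposition into trails *)

Section Trails.
Variables (V : finType) (T : eqType) (e : V -> V -> T).
Hypothesis e_sym : forall x y, e x y = e y x.
Implicit Types (t : V * seq V) (ts : seq (V * seq V)).

Definition trail_edges t := pairmap e t.1 t.2.
Definition edges ts := flatten [seq trail_edges t | t <- ts].

Lemma last_rev_belast (x : V) s : last (last x s) (rev (belast x s)) = x.
Proof. by case: s => //= a s; rewrite rev_cons last_rcons. Qed.

Lemma pairmap_rev x s :
  pairmap e (last x s) (rev (belast x s)) = rev (pairmap e x s).
Proof.
elim: s x => [|y s IH] x //=.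
rewrite !rev_cons -!cats1 pairmap_cat IH /=.
by rewrite last_rev_belast e_sym.
Qed.

(* Two trails with the same head merge into one, after reversing the first. *)
Lemma add_trail ts t : uniq (unzip1 ts) ->
  exists2 ts', uniq (unzip1 ts') & perm_eq (edges ts') (trail_edges t ++ edges ts).
Proof.
have [N] := ubnP (size ts); elim: N ts t => // N IH ts t.
have [/mapP[t1 t1ts E]|tNts] := boolP (t.1 \in unzip1 ts); last first.
  by exists (t :: ts); rewrite /= ?tNts.
move=> sz uniq_ts; have tsE := perm_to_rem t1ts.
(* The new head, the last vertex of [t], may again be a head in the list; but the list is shorter
   now. *)
pose t' := (last t.1 t.2, rev (belast t.1 t.2) ++ t1.2).
have [||ts' ? ts'E] := IH (rem t1 ts) t'.
- by rewrite size_rem // prednK //; case: (ts) t1ts.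
- by move: uniq_ts; rewrite (perm_uniq (perm_map fst tsE)) => /andP[].
exists ts' => //; apply: (perm_trans ts'E); rewrite /t' /trail_edges /= pairmap_cat.
rewrite pairmap_rev last_rev_belast -catA.
apply: perm_cat; first by rewrite perm_rev.
by rewrite perm_sym E; apply: perm_flatten (perm_map _ tsE).
Qed.

Lemma trail_decomposition (s : seq (V * V)) :
  exists2 ts, uniq (unzip1 ts) & perm_eq (edges ts) [seq e p.1 p.2 | p <- s].
Proof.
elim: s => [|p s [ts /(add_trail (p.1, [:: p.2]))[ts' uniq_ts' ts'E] tsE]].
  by exists [::].
by exists ts' => //; apply: (perm_trans ts'E); rewrite /= perm_cons.
Qed.

(* Each trail is closed by a separator [inr x] labelled by its own head [x]. *)
Definition word_of ts : seq (V + V) :=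
  flatten [seq rcons (map inl (t.1 :: t.2)) (inr t.1) | t <- ts].

Definition word_edge (x y : V + V) : option T :=
  if (x, y) is (inl a, inl b) then Some (e a b) else None.

Lemma word_edges z ts :
  pmap id (pairmap word_edge (inr z) (word_of ts)) = edges ts.
Proof.
have trailE w x s : pmap id (pairmap word_edge (inl x) (rcons (map inl s) (inr w))) =
    pairmap e x s by elim: s x => //= y s IHs x; rewrite -IHs.
elim: ts z => [|t ts IH] z //=.
by rewrite pairmap_cat last_rcons pmap_cat IH trailE.
Qed.

Lemma count_word_sep x ts : count_mem (inr x) (word_of ts) = count_mem x (unzip1 ts).
Proof.
elim: ts => //= t ts IH; rewrite count_cat IH -cats1 count_cat /= addn0; congr addn.
rewrite (_ : count _ _ = 0%N) //; apply/count_memPn/negP => /mapP[] //.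
Qed.

Lemma nth_pmap_inj (l : seq (option T)) i j (t : T) : uniq (pmap id l) ->
  nth None l i = Some t -> nth None l j = Some t -> i = j.
Proof.
have inl' (l' : seq (option T)) n : nth None l' n = Some t -> t \in pmap id l'.
  move=> E; rewrite mem_pmap; apply/mapP; exists (Some t) => //.
  by rewrite -E mem_nth // ltnNge; apply/negP => /(nth_default None); rewrite E.
elim: l i j => [|a l IH] [|i] [|j] //= l_uniq.
- by move=> aE /inl' tl; move: l_uniq; rewrite aE /= tl.
- by move=> /inl' tl aE; move: l_uniq; rewrite aE /= tl.
- by move=> Ei Ej; rewrite (IH i j) //; case: (a) l_uniq => //= b /andP[].
Qed.

(** [W] is the sequence of colours to be used: separators do not repeat because the heads are
    distinct, and no edge is traversed twice because the labels are distinct. *)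
Lemma trail_word (s : seq (V * V)) : uniq [seq e p.1 p.2 | p <- s] ->
  exists W : seq (V + V), [/\ (size s <= size W)%N,
    forall z i j x, (i < size W)%N -> (j < size W)%N ->
      nth z W i = inr x -> nth z W j = inr x -> i = j,
    forall z i x y, (i.+1 < size W)%N -> nth z W i = inl x ->
      nth z W i.+1 = inl y -> e x y \in [seq e p.1 p.2 | p <- s] &
    forall z i j x y x' y', (i.+1 < size W)%N -> (j.+1 < size W)%N ->
      nth z W i = inl x -> nth z W i.+1 = inl y ->
      nth z W j = inl x' -> nth z W j.+1 = inl y' -> e x y = e x' y' -> i = j].
Proof.
have [ts uniq_ts tsE] := trail_decomposition s; rewrite -(perm_uniq tsE) => uniq_e.
(* The separator put in front of the word shifts positions by one. *)
exists (word_of ts); have edgeE z v i x y : (i.+1 < size (word_of ts))%N ->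
    nth z (word_of ts) i = inl x -> nth z (word_of ts) i.+1 = inl y ->
    nth None (pairmap word_edge (inr v) (word_of ts)) i.+1 = Some (e x y).
  by move=> iW Ex Ey; rewrite (nth_pairmap z) //= Ex Ey.
split.
(* A trail with [l] edges contributes [l + 2] letters. *)
- rewrite -(size_map (fun p => e p.1 p.2)) -(perm_size tsE).
  rewrite /edges /word_of; elim: (ts) => //= t ts' IH; rewrite !size_cat /trail_edges.
  by rewrite size_pairmap size_rcons size_map addSn ltnW // ltnS leqW // leq_add2l.
- move=> z i j x iW jW Ei Ej; apply/eqP; apply/negP => /negP ij.
  have : (count_mem (inr x) (word_of ts) <= 1)%N.
    by rewrite count_word_sep count_uniq_mem //; case: (_ \in _).
  wlog {ij} ij : i j iW jW Ei Ej / (i < j)%N.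
    by move=> H; case: (ltngtP i j) ij => // ? _; [apply: (H i j)|apply: (H j i)].
  rewrite -(cat_take_drop j (word_of ts)) count_cat (drop_nth z jW) /= Ej eqxx.
  have : inr x \in take j (word_of ts).
    by rewrite -Ei -(nth_take z ij) mem_nth // size_take jW.
  rewrite -has_pred1 has_count; case: (count _ (take _ _)) => // c _.
  by rewrite add1n addnS addSn.
- move=> z i x y iW Ex Ey; rewrite -(perm_mem tsE) -(word_edges x).
  rewrite mem_pmap; apply/mapP; exists (Some (e x y)) => //.
  by rewrite -(edgeE z x i) // mem_nth // size_pairmap.
- move=> z i j x y x' y' iW jW Ex Ey Ex' Ey' E; apply: succn_inj.
  rewrite -(word_edges x) in uniq_e.
  by apply: (nth_pmap_inj uniq_e (edgeE z x i x y _ _ _)); rewrite // E; apply: edgeE Ey'.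
Qed.

End Trails.

(** * Colouring Gale-even sets *)

Definition above (n : nat) (S : {set 'I_n}) (j : 'I_n) : {set 'I_n} :=
  [set i in S | (j < i)%N].

(** This is Gale's criterion: the elements of [S] between two vertices outside [S] are counted by a
    difference of two values of [#|above S j|]. *)
Definition gale_even (n : nat) (S : {set 'I_n}) : Prop :=
  exists b : bool, forall j, j \notin S -> odd #|above S j| = b.

Definition below (n : nat) (S : {set 'I_n}) (j : nat) : {set 'I_n} :=
  [set i in S | (i < j)%N].

Lemma card_belowS (n : nat) (S : {set 'I_n}) (j : 'I_n) :
  #|below S j.+1| = (#|below S j| + (j \in S))%N.
Proof.
have [jS|jS] := boolP (j \in S); last first.
  rewrite addn0; apply: eq_card => i; rewrite !inE ltnS leq_eqVlt.
  by case: eqP => [/val_inj->|//]; rewrite (negPf jS).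
rewrite addn1 (cardsD1 j) inE jS ltnSn; congr _.+1.
by apply: eq_card => i; rewrite !inE ltnS ltn_neqAle -val_eqE andbCA.
Qed.

Lemma card_below_above (n : nat) (S : {set 'I_n}) (j : 'I_n) : j \notin S ->
  (#|below S j| + #|above S j|)%N = #|S|.
Proof.
move=> jS; rewrite -cardsUI (_ : _ :&: _ = set0) ?cards0 ?addn0.
  apply: eq_card => i; rewrite !inE -andb_orr -neq_ltn.
  by case: (boolP (i \in S)) => // iS; apply/negP => /eqP/val_inj E; rewrite -E iS in jS.
by apply/setP => i; rewrite !inE; case: ltngtP; rewrite !andbF.
Qed.

(* The left ends of the consecutive pairs that make up a Gale-even set. *)
Lemma gale_pairs (m : nat) (S : {set 'I_m.+1}) :
  ~~ odd #|S| -> gale_even S -> ord_max \notin S ->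
  exists A : {set 'I_m.+1}, [/\ (#|A|.*2 <= #|S|)%N,
    forall a, a \in A -> [/\ a \in S, (a.+1 < m.+1)%N & inord a.+1 \in S] &
    forall p, p \in S -> exists2 a, a \in A & p = a \/ p = a.+1 :> nat].
Proof.
move=> Seven [b Sb] mS.
(* Nothing lies above [ord_max], so the common parity is even; since [#|S|] is even, the counts
   below are even too. *)
have {b Sb} ev (j : 'I_m.+1) : j \notin S -> ~~ odd #|below S j|.
  have b0 : b = false.
    rewrite -(Sb _ mS); suff -> : above S ord_max = set0 by rewrite cards0.
    by apply/setP => i; rewrite !inE ltnNge -ltnS ltn_ord andbF.
  move=> jS; move: Seven; rewrite -(card_below_above jS) oddD (Sb _ jS) b0.
  by rewrite addbF.
(* With evenly many elements below it, [a] opens a pair: its successor has oddly many, so it cannot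
   lie outside [S]. *)
pose A := [set a in S | ~~ odd #|below S a|].
have AP a : a \in A -> [/\ a \in S, (a.+1 < m.+1)%N & inord a.+1 \in S :\: A].
  rewrite inE => /andP[aS ea].
  have am : (a.+1 < m.+1)%N.
    rewrite ltnS ltn_neqAle -ltnS ltn_ord andbT; apply: contraNneq mS => E.
    by rewrite (_ : ord_max = a) //; apply: val_inj; rewrite /= E.
  have odd1 : odd #|below S (inord a.+1 : 'I_m.+1)|.
    by rewrite inordK // card_belowS aS addn1.
  have aS1 : inord a.+1 \in S by apply: contraLR odd1; apply: ev.
  by split=> //; rewrite !inE odd1 aS1.
exists A; split.
- rewrite -addnn -(cardsID A S) leq_add //.
    apply: subset_leq_card; apply/subsetP => a aA.
    by rewrite inE aA; case: (AP a aA) => ->.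
  rewrite -(@card_in_imset _ _ (fun a : 'I_m.+1 => inord a.+1 : 'I_m.+1)).
    by apply: subset_leq_card; apply/subsetP => _ /imsetP[a /AP[_ _ ?] ->].
  move=> a a' /AP[_ am _] /AP[_ am' _] /(congr1 (fun i : 'I__ => val i)).
  by rewrite /= !inordK // => -[/val_inj].
- by move=> a /AP[aS am]; rewrite inE => /andP[].
- move=> p pS; have [pA|pA] := boolP (p \in A); first by exists p; [|left].
  have op : odd #|below S p| by move: pA; rewrite inE pS negbK.
  case: p => [[|p] pm] in pS pA op *.
    move: op; rewrite (_ : below S _ = set0) ?cards0 //.
    by apply/setP => i; rewrite !inE ltn0 andbF.
  have pm' := ltnW pm; exists (Ordinal pm'); last by right.
  have := card_belowS S (Ordinal pm'); rewrite /= => E.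
  have : Ordinal pm' \in S.
    by apply: contraLR op => pNS; rewrite E (negPf pNS) addn0; apply: (ev (Ordinal pm')).
  by move: op; rewrite /= E !inE => + pS'; rewrite pS' oddD addbT.
Qed.

(** * From the graph to a conflict-free colouring *)

Lemma chi_cf_le (V C : finType) (H : hypergraph V) (phi : V -> C) :
  conflict_free H phi -> (chi_cf H <= #|C|)%N.
Proof.
move=> cf; rewrite /chi_cf; case: ex_minnP => c _; apply.
apply/existsP; exists [ffun v => enum_rank (phi v)].
apply/forall_inP => e eH; apply/implyP => e0.
have /exists_inP[x xe /forall_inP uniq_x] := implyP (forall_inP cf e eH) e0.
apply/exists_inP; exists x => //; apply/forall_inP => y /uniq_x.
by rewrite !ffunE (inj_eq enum_rank_inj).
Qed.

(** Labels ignore direction, since trails get reversed; pairs on one side have the dummy label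
    [None]. *)
Definition incidence (P L : Type) (x y : P + L) : option (P * L) :=
  match x, y with
  | inl p, inr l | inr l, inl p => Some (p, l)
  | _, _ => None
  end.

Lemma incidenceC (P L : Type) (x y : P + L) : incidence x y = incidence y x.
Proof. by case: x y => [p|l] []. Qed.

(** The colours are the vertices of the graph, one separator for each, and one extra colour. In a
    hyperedge without unique colour, the graph edges under its pairs meet one another at both ends,
    so [min_degree_card] makes them too many. *)
Lemma chi_cf_gale (F : finFieldType) (h o n : nat) (H : hypergraph 'I_n) :
  (0 < h)%N -> (o <= 1)%N -> (n <= #|{: unip F h o}|)%N ->
  (forall S, S \in H -> [/\ ~~ odd #|S|, gale_even S &
                           (#|S| <= (h.*2 + o).*2.+1.*2)%N]) ->
  (chi_cf H <= (#|{: point_coset F h o}| + #|{: line_coset F h o}|).*2.+1)%N.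
Proof.
move=> h0 o1 nU HP; case: n => [|m] in H nU HP *.
  apply: leq_trans (chi_cf_le (C := unit) (phi := fun=> tt) _) _;
    last by rewrite card_unit.
  apply/forall_inP => e _; apply/implyP => /set0Pn[[]] //.
pose V := (point_coset F h o + line_coset F h o)%type.
pose ends (u : unip F h o) : V * V := (inl (point_of u), inr (line_of u)).
pose s := [seq ends u | u <- enum {: unip F h o}].
have endsE : [seq incidence p.1 p.2 | p <- s] =
    [seq Some (point_of u, line_of u) | u <- enum {: unip F h o}].
  by rewrite -map_comp.
have [|W [sW Wsep Wedge Winj]] :=
  @trail_word {: V} _ (@incidence _ _) (@incidenceC _ _) s.
  rewrite endsE map_inj_uniq ?enum_uniq //.
  exact: inj_comp (@Some_inj _) (@point_line_inj F h o).
have {sW} nW : (m.+1 <= size W)%N.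
  by apply: leq_trans nU (leq_trans _ sW); rewrite size_map -cardE.
have z : V + V by case: (W) nW.
(* [None] is used once, so a hyperedge without unique colour avoids [ord_max], as [gale_pairs]
   requires. *)
pose phi (i : 'I_m.+1) := if i == ord_max then None else Some (nth z W i).
have -> : (#|{: point_coset F h o}| + #|{: line_coset F h o}|).*2.+1 = #|{: option (V + V)}|.
  by rewrite card_option !card_sum addnn.
apply: (@chi_cf_le _ _ _ phi); apply/forall_inP => S /HP[Seven Sgale Scard].
apply/implyP => S0; apply: contraT => noU.
have twin x : x \in S -> exists y, [/\ y \in S, y != x & phi y = phi x].
  move=> xS; have /forall_inPn[y] := exists_inPn noU x xS.
  by rewrite !inE negbK => /andP[yx yS] /eqP; exists y.
have mS : ord_max \notin S.
  apply/negP => /twin[y [_ yN]]; rewrite /phi eqxx (negPf yN) //.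
have phiE i : i \in S -> phi i = Some (nth z W i).
  by move=> iS; rewrite /phi ifN //; apply: contraNneq mS => <-.
have SW (i : 'I_m.+1) : i \in S -> exists x : V, nth z W i = inl x.
  move=> iS; case Ei: (nth z W i) => [x|x]; first by exists x.
  have [y [yS /eqP yi E]] := twin i iS; case: yi; apply/val_inj.
  move: E; rewrite !phiE // Ei => -[Ey].
  by apply: (Wsep z _ _ x) => //; exact: leq_trans (ltn_ord _) nW.
have {}twin (p : 'I_m.+1) x : p \in S -> nth z W p = inl x ->
    exists p', [/\ p' \in S, p' != p & nth z W p' = inl x].
  move=> pS Ep; have [y [yS yp E]] := twin p pS; exists y; split=> //.
  by move: E; rewrite !phiE // Ep => -[].
have [A [Acard AS SA]] := gale_pairs Seven Sgale mS.
(* The default is not met on [S], where separators have just been excluded. *)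
pose color i : V :=
  if nth z W i is inl x then x else (if z is inl x then x else inl (point_of 0)).
have colorE (i : 'I_m.+1) : i \in S -> nth z W i = inl (color i).
  by move=> /SW[x E]; rewrite /color E.
have colorS a : a \in A -> nth z W a.+1 = inl (color a.+1).
  by move=> /AS[_ am /colorE]; rewrite inordK.
pose edge_at i := incidence (color i) (color i.+1).
pose g (a : 'I_m.+1) : unip F h o :=
  odflt (0, 0, 0) [pick u | edge_at a == Some (point_of u, line_of u)].
have gP a : a \in A -> edge_at a = Some (point_of (g a), line_of (g a)).
  move=> aA; have [aS am aS1] := AS a aA.
  have aW : (a.+1 < size W)%N by apply: leq_trans nW.
  have := Wedge z a _ _ aW (colorE _ aS) (colorS _ aA).
  rewrite endsE => /mapP[u _ E].
  by rewrite /g; case: pickP => [v /eqP //|/(_ u)]; rewrite /edge_at E eqxx.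
have g_inj a a' : a \in A -> a' \in A -> g a = g a' -> a = a'.
  move=> aA a'A E; have [aS am aS1] := AS a aA; have [a'S a'm a'S1] := AS a' a'A.
  apply/val_inj/(Winj z _ _ (color a) (color a.+1) (color a') (color a'.+1)).
  - by apply: leq_trans nW.
  - by apply: leq_trans nW.
  - exact: colorE.
  - exact: colorS.
  - exact: colorE.
  - exact: colorS.
  - by have := gP a aA; rewrite E -gP.
suff : ((h.*2 + o).*2.+1 < #|g @: A|)%N.
  rewrite ltnNge => /negP[]; apply: leq_trans (leq_imset_card _ _) _.
  by rewrite -leq_double (leq_trans Acard).
apply: min_degree_card => //.
  have /set0Pn[p /SA[a aA _]] := S0.
  by apply/set0Pn; exists (g a); apply: imset_f.
move=> _ /imsetP[a aA ->] b.
have [aS am aS1] := AS a aA.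
pose v : V := if b then inl (point_of (g a)) else inr (line_of (g a)).
have incident a' : a' \in A -> (color a' == v) || (color a'.+1 == v) =
    (if b then point_of (g a') == point_of (g a) else line_of (g a') == line_of (g a)).
  move=> a'A; have := gP a' a'A; rewrite /edge_at /v.
  case: (color a') (color a'.+1) => [x|x] [y|y] //= [-> ->]; case: (b);
  by rewrite ?orbF.
have distinct a' : a' \in A -> color a' != color a'.+1.
  move=> a'A; have := gP a' a'A; rewrite /edge_at.
  by case: (color a') (color a'.+1) => [x|x] [y|y].
(* [p] is the member of the pair of [a] coloured [v]. Its twin [p'] lies in another pair, as the two
   members of one pair differ in colour. *)
have [p [pS pa pv]] : exists p : 'I_m.+1,
    [/\ p \in S, p = a \/ p = a.+1 :> nat & color p = v].
  have : (color a == v) || (color a.+1 == v) by rewrite incident //; case: (b).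
  case/orP => /eqP E; first by exists a; split=> //; left.
  by exists (inord a.+1); rewrite inordK //; split=> //; right.
have [p' [p'S p'p p'v]] := twin p v pS (etrans (colorE _ pS) (congr1 inl pv)).
have {}p'v : color p' = v by rewrite /color p'v.
have [a' a'A p'a'] := SA p' p'S.
exists (g a'); first exact: imset_f.
have inc : (color a' == v) || (color a'.+1 == v).
  by case: p'a' => <-; rewrite p'v eqxx ?orbT.
rewrite adjacent_sym /adjacent; move: inc; rewrite incident // => ->; rewrite andTb.
apply/eqP => /(g_inj a' a a'A aA) E; rewrite {a'}E in p'a' a'A.
have := distinct a aA.
case: pa p'a' => pE [p'E|p'E].
- by move: p'p; rewrite -val_eqE /= pE p'E eqxx.
- by rewrite -p'E -pE pv p'v eqxx.
- by rewrite -pE -p'E pv p'v eqxx.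
- by move: p'p; rewrite -val_eqE /= pE p'E eqxx.
Qed.

(** * Facets of the cyclic polytope *)

From mathcomp Require Import all_classical all_reals all_analysis.

Import numFieldNormedType.Exports.

Section CyclicPolytope.
Variable R : realType.

(** The convex combinations form a convex set containing every [g i], hence contain the hull. *)
Lemma convex_hull_combination (E : lmodType R) (n : nat) (g : 'I_n -> E) (x : E) :
  convex_hull (range g) x -> exists l : 'I_n -> R,
    [/\ forall i, 0 <= l i, \sum_i l i = 1 & x = \sum_i l i *: g i].
Proof.
pose X : set E := [set y | exists l : 'I_n -> R,
  [/\ forall i, 0 <= l i, \sum_i l i = 1 & y = \sum_i l i *: g i]]%classic.
apply: (@smallest_sub _ (@convex_set R E) _ X) => [y z k|_ [i _ <-]]; last first.
  exists (fun j => (j == i)%:R); split=> [j||]; first exact: ler0n.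
    by rewrite (bigD1 i) //= eqxx big1 ?addr0 // => j /negPf->.
  by rewrite (bigD1 i) //= eqxx scale1r big1 ?addr0 // => j /negPf->; rewrite scale0r.
rewrite !inE => -[ly [ly0 ly1 ->]] [lz [lz0 lz1 ->]].
exists (fun i => k%:num * ly i + (1 - k%:num) * lz i); split=> [i||].
- by rewrite addr_ge0 // mulr_ge0 // subr_ge0; apply: le1.
- by rewrite big_split /= -!mulr_sumr ly1 lz1 !mulr1 addrC subrK.
- rewrite [LHS](_ : _ = k%:num *: (\sum_i ly i *: g i) +
      (1 - k%:num) *: (\sum_i lz i *: g i)) //.
  rewrite !scaler_sumr -big_split; apply: eq_bigr => i _ /=.
  by rewrite [RHS]scalerDl -!scalerA.
Qed.

Lemma combination_at_max (n : nat) (l a : 'I_n -> R) (c : R) :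
  (forall i, 0 <= l i) -> \sum_i l i = 1 -> (forall i, a i <= c) ->
  \sum_i l i * a i = c -> forall i, a i != c -> l i = 0.
Proof.
move=> l0 l1 ac E i ai.
have : \sum_i l i * (c - a i) = 0.
  transitivity (\sum_i l i * c - \sum_i l i * a i).
    by rewrite -sumrB; apply: eq_bigr => j _; rewrite mulrBr.
  by rewrite -mulr_suml l1 mul1r E subrr.
move=> /psumr_eq0P /(_ i isT)/eqP.
rewrite mulf_eq0 subr_eq0 [c == _]eq_sym (negPf ai) orbF.
by move=> H; apply/eqP/H => j _; rewrite mulr_ge0 // subr_ge0.
Qed.

(** The [m] rows of coefficients lie in dimension [#|T| < m], hence are linearly dependent; the
    weights of a relation sum to 0 because each row sums to 1. *)
Lemma dependent_combinations (E : lmodType R) (m n : nat) (g : 'I_n -> E)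
    (T : {set 'I_n}) (l : 'I_m -> 'I_n -> R) :
  (#|T| < m)%N -> (forall j i, i \notin T -> l j i = 0) ->
  (forall j, \sum_i l j i = 1) ->
  ~ affinely_independent (fun j => \sum_i l j i *: g i).
Proof.
move=> Tm lT l1 indep.
pose L := \matrix_(j < m, k < #|T|) l j (enum_val k).
have : kermx L != 0.
  rewrite kermx_eq0 /row_free neq_ltn (leq_ltn_trans (rank_leq_col L)) //.
move=> /rowV0Pn[w /sub_kermxP wL /eqP]; apply; apply/rowP => j; rewrite [RHS]mxE.
have wl i : \sum_j w 0 j * l j i = 0.
  have [iT|iT] := boolP (i \in T); last by rewrite big1 // => k _; rewrite lT ?mulr0.
  have /rowP/(_ (enum_rank_in iT i)) := wL; rewrite !mxE => E'; rewrite -[RHS]E'.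
  by apply: eq_bigr => k _; rewrite mxE enum_rankK_in.
apply: (indep (fun j => w 0 j)).
  transitivity (\sum_j \sum_i w 0 j * l j i).
    by apply: eq_bigr => k _; rewrite -mulr_sumr l1 mulr1.
  by rewrite exchange_big /= big1.
transitivity (\sum_k \sum_i (w 0 k * l k i) *: g i).
  by apply: eq_bigr => k _; rewrite scaler_sumr; apply: eq_bigr => i _; rewrite scalerA.
rewrite exchange_big /= big1 // => i _.
by rewrite -scaler_suml wl scale0r.
Qed.

(** An affine relation annihilates all polynomials of degree at most [d] at the [t j]; it is tested
    on the one vanishing at all of them but [t i]. *)
Lemma moment_curve_independent (d m : nat) (t : 'I_m -> R) :
  injective t -> (m <= d.+1)%N ->
  affinely_independent (fun j => moment_curve d (t j)).
Proof.
move=> t_inj md w w0 wg i.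
pose rs := [seq t l | l <- enum 'I_m & l != i].
pose q := \prod_(z <- rs) ('X - z%:P).
have size_q : (size q <= d.+1)%N.
  apply: leq_trans md; rewrite size_prod_XsubC size_map size_filter.
  have := count_predC (pred1 i) (enum 'I_m).
  rewrite size_enum_ord count_uniq_mem ?enum_uniq // mem_enum => E.
  by rewrite -[leqRHS]E inE add1n.
have root_q j : (q.[t j] == 0) = (j != i).
  rewrite -rootE root_prod_XsubC mem_map // mem_filter mem_enum andbT //.
have : \sum_j w j * q.[t j] = 0.
  transitivity (\sum_j \sum_(k < d.+1) q`_k * (w j * t j ^+ k)).
    apply: eq_bigr => j _; rewrite (horner_coef_wide _ size_q) mulr_sumr.
    by apply: eq_bigr => k _; ring.
  rewrite exchange_big /= big1 // => -[[|k] kd] _ /=; rewrite -mulr_sumr.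
    by under eq_bigr do rewrite expr0 mulr1; rewrite w0 mulr0.
  have /rowP/(_ (Ordinal (kd : (k < d)%N))) := wg.
  rewrite summxE mxE => E; rewrite -[X in _ * X = _]/(\sum_j w j * t j ^+ k.+1).
  rewrite [X in _ * X](_ : _ = 0) ?mulr0 // -[RHS]E.
  by apply: eq_bigr => j _; rewrite !mxE.
rewrite (bigD1 i) //= big1 ?addr0 => [/eqP|j].
  by rewrite mulf_eq0 root_q eqxx orbF => /eqP.
by rewrite -root_q => /eqP->; rewrite mulr0.
Qed.

(** * Linear functionals along the moment curve *)

Definition dual_form (d : nat) (a : 'cV[R]_d) (x : 'rV[R]_d) : R := (x *m a) 0 0.

Lemma dual_form_linear (d : nat) (a : 'cV[R]_d) : scalar (dual_form a).
Proof. by move=> k x y; rewrite /dual_form mulmxDl -scalemxAl !mxE. Qed.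

HB.instance Definition _ (d : nat) (a : 'cV[R]_d) :=
  GRing.isLinear.Build R 'rV[R]_d R *%R (dual_form a) (dual_form_linear a).

Definition form_poly (d : nat) (f : 'rV[R]_d -> R) (c : R) : {poly R} :=
  \sum_(j < d) f (delta_mx 0 j) *: 'X^(j.+1) - c%:P.

Lemma horner_form_poly (d : nat) (f : {scalar 'rV[R]_d}) (c t : R) :
  (form_poly f c).[t] = f (moment_curve d t) - c.
Proof.
rewrite hornerD hornerN hornerC horner_sum; congr (_ - _).
rewrite [moment_curve d t]row_sum_delta linear_sum; apply: eq_bigr => j _.
by rewrite hornerZ hornerXn linearZ mxE mulrC.
Qed.

Lemma size_form_poly (d : nat) (f : 'rV[R]_d -> R) (c : R) :
  (size (form_poly f c) <= d.+1)%N.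
Proof.
rewrite (leq_trans (size_polyD _ _)) // geq_max size_polyN.
rewrite (leq_trans (size_polyC_leq1 _)) // andbT.
apply: (leq_trans (size_sum _ _ _)); apply/bigmax_leqP => j _.
by rewrite (leq_trans (size_scale_leq _ _)) // size_polyXn ltnS.
Qed.

(** The hyperplane of the facet meets the curve in the roots of a polynomial of degree at most [d],
    and dimension forces [d] nodes to be roots. At the other nodes the polynomial is negative, which
    fixes the parity of the number of roots above. *)
Lemma FC_gale (d n : nat) (S : {set 'I_n}) : (1 < d < n)%N -> S \in FC R d n ->
  #|S| = d /\ gale_even S.
Proof.
move=> /andP[d1 dn]; rewrite inE => /asboolP[F [[[f [c [fc FE]]] [m [Pdim Fdim]]] SF]].
pose node (i : 'I_n) : R := i.+1%:R.
pose pt (i : 'I_n) := cyclic_point R d i.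
have node_inj : injective node by move=> i j /eqP; rewrite eqr_nat => /eqP[/val_inj].
have ptP i : cyclic_polytope n (pt i) by apply: sub_gen_smallest; exists i.
pose T : {set 'I_n} := [set i | f (pt i) == c].
pose p := form_poly f c.
have pE i : p.[node i] = f (pt i) - c by exact: horner_form_poly.
have rootT i : root p (node i) = (i \in T) by rewrite inE rootE pE subr_eq0.
have P_supp (l : 'I_n -> R) : (forall i, 0 <= l i) -> \sum_i l i = 1 ->
    f (\sum_i l i *: pt i) = c -> forall i, i \notin T -> l i = 0.
  move=> l0 l1 E i iT; apply: (@combination_at_max _ l (fun i => f (pt i)) c) => //.
  - by move=> j; apply: fc.
  - by rewrite -[RHS]E linear_sum; apply: eq_bigr => j _; rewrite linearZ.
  - by rewrite inE in iT.
(* Otherwise [F] would contain [m.+2] affinely independent points of the polytope. *)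
have p0 : p != 0.
  apply/eqP => p0; case: Fdim => _; apply; case: Pdim => -[x [xP xind] _].
  exists x; split=> // j; rewrite FE; split=> //.
  have [l [_ l1 ->]] := convex_hull_combination (xP j); rewrite linear_sum.
  rewrite -[RHS]mul1r -l1 mulr_suml; apply: eq_bigr => i _; rewrite linearZ /=.
  by congr (_ * _); apply/eqP; have := rootT i; rewrite p0 root0 inE => /esym.
pose rs := [seq node i | i <- enum T].
have rs_root : all (root p) rs.
  by apply/allP => _ /mapP[i iT ->]; rewrite rootT -mem_enum.
have rs_uniq : uniq rs by rewrite map_inj_uniq ?enum_uniq.
have sizeT : size rs = #|T| by rewrite size_map -cardE.
have size_p : (size p <= d.+1)%N := size_form_poly _ _.
(* Otherwise [m.+3 <= d.+1] points of the curve would be affinely independent. *)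
have dm : (d <= m.+1)%N.
  rewrite leqNgt; apply/negP => md; case: Pdim => _; apply.
  have mn : (m.+3 <= n)%N by lia.
  exists (fun j => pt (widen_ord mn j)); split=> [j|]; first exact: ptP.
  by apply: (@moment_curve_independent d _ (fun j => node (widen_ord mn j)));
    [move=> i j /node_inj/(congr1 val)/= /val_inj | lia].
(* Otherwise the [m.+1] independent points of [F] would be combinations of at most [m] points. *)
have dT : (d <= #|T|)%N.
  rewrite leqNgt; apply/negP => Td; case: Fdim => -[x [xF xind] _].
  have /choice[l lP] j : exists l : 'I_n -> R, [/\ forall i, i \notin T -> l i = 0,
      \sum_i l i = 1 & x j = \sum_i l i *: pt i].
    have := xF j; rewrite FE => -[/convex_hull_combination[l [l0 l1 ->]] fx].
    by exists l; split=> //; apply: P_supp.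
  apply: (@dependent_combinations _ m.+1 n pt T l) => //.
  - exact: leq_trans dm.
  - by move=> j; case: (lP j).
  - by move=> j; case: (lP j).
  - by rewrite (_ : (fun j => _) = x) //; apply/funext => j; case: (lP j).
have Td : #|T| = d.
  by apply/eqP; rewrite eqn_leq dT andbT -ltnS -sizeT (leq_trans (max_poly_roots p0 _ _)).
have TF i : i \in T -> F (pt i) by rewrite inE FE => /eqP.
have FT i : F (pt i) -> i \in T by rewrite inE FE => -[_ ->].
have pt_inj : injective pt.
  move=> i j /rowP/(_ (Ordinal (ltnW d1))); rewrite !mxE /= !expr1; exact: node_inj.
(* The functional [2 s x_0 - x_1] equals [s ^ 2 - (t - s) ^ 2] along the curve. *)
have vertexT i : i \in T -> vertices F (pt i).
  move=> iT; pose s := node i.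
  pose a : 'cV[R]_d := \col_j
    (if j == 0 :> nat then s *+ 2 else if j == 1 :> nat then -1 else 0).
  have aE j : dual_form a (pt j) = s ^+ 2 - (node j - s) ^+ 2.
    rewrite /dual_form mxE (bigD1 (Ordinal (ltnW d1))) //= (bigD1 (Ordinal d1)) //=.
    rewrite big1 ?addr0 => [|[[|[|k]] kd] //=]; rewrite !mxE //= ?mulr0 // -/(node j).
    by rewrite expr1; ring.
  have aF x : F x -> exists2 l : 'I_n -> R,
      [/\ forall j, 0 <= l j, \sum_j l j = 1 & x = \sum_j l j *: pt j] &
      dual_form a x = \sum_j l j * dual_form a (pt j).
    rewrite {1}FE => -[/convex_hull_combination[l [l0 l1 ->]] _].
    by exists l => //; rewrite linear_sum; apply: eq_bigr => j _; rewrite linearZ.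
  have a_le j : dual_form a (pt j) <= s ^+ 2 by rewrite aE gerBl sqr_ge0.
  exists (dual_form a), (s ^+ 2); split.
    move=> x /aF[l [l0 l1 _] axE]; rewrite [leLHS]axE -[leRHS]mul1r -l1 mulr_suml.
    by apply: ler_sum => j _; rewrite ler_wpM2l.
  apply/seteqP; split=> [_ ->|x [/aF[l [l0 l1 ->] axE] E]].
    by split; [exact: TF|rewrite [LHS]aE subrr expr0n subr0].
  have l_i j : j != i -> l j = 0.
    move=> ji; apply: (combination_at_max l0 l1 a_le (etrans (esym axE) E)).
    rewrite aE -subr_eq0 addrC addKr oppr_eq0 sqrf_eq0 subr_eq0.
    by apply: contraNneq ji => /node_inj ->.
  have li1 : l i = 1 by rewrite -l1 (bigD1 i) //= big1 ?addr0 // => j /l_i.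
  by rewrite (bigD1 i) //= li1 scale1r big1 ?addr0 // => j /l_i ->; rewrite scale0r.
have vertexF x : vertices F x -> F x.
  move=> [g [b [_ /seteqP[/(_ x erefl)[]]]]] //.
have -> : S = T.
  apply/setP => i; apply/idP/idP => [iS|iT].
    by apply/FT/vertexF; rewrite -SF; exists i.
  by have := vertexT i iT; rewrite -SF => -[j jS /pt_inj <-].
split=> //.
have p_prod : p = lead_coef p *: \prod_(z <- rs) ('X - z%:P).
  apply: all_roots_prod_XsubC => //; last by rewrite uniq_rootsE.
  apply/eqP; rewrite eqn_leq sizeT Td size_p -Td -sizeT.
  exact: max_poly_roots.
(* A negative value with positive leading coefficient means an odd number of negative factors. *)
exists (0 < lead_coef p) => j jT.
have pj_lt0 : p.[node j] < 0.
  rewrite lt_neqAle -rootE rootT jT pE subr_le0; exact: fc.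
have sgE i : Num.sg (node j - node i) = (-1) ^+ (j < i)%N :> R \/ i = j.
  have [ji|ij|/val_inj] := ltngtP j i; [left|left|by right].
    by rewrite ltr0_sg ?expr1 // subr_lt0 ltr_nat.
  by rewrite gtr0_sg ?expr0 // subr_gt0 ltr_nat.
have sg_prod : Num.sg (\prod_(z <- rs) (node j - z)) = (-1) ^+ #|above T j| :> R.
  rewrite big_map big_enum (big_morph _ (@sgrM R) (@sgr1 R)) /=.
  rewrite /above -sum1dep_card big_mkcondr -prodrXr; apply: eq_bigr => i iT.
  by case: (sgE i) => [->|E]; [case: ltnP|rewrite -E iT in jT].
have pjE : p.[node j] = lead_coef p * \prod_(z <- rs) (node j - z).
  rewrite {1}p_prod hornerZ horner_prod; congr (_ * _).
  by apply: eq_bigr => z _; rewrite hornerXsubC.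
move: pj_lt0; rewrite -sgr_cp0 pjE sgrM sg_prod -signr_odd.
have : lead_coef p != 0 by rewrite lead_coef_eq0.
by case: sgrP => // _ _; case: (odd _) => //=;
  rewrite ?expr0 ?expr1 ?mulrNN ?mulr1 => /eqP; lra.
Qed.

End CyclicPolytope.

(** * Asymptotics *)

(** With [q = 2 ^ e.+1] the graph has [2 * q ^ L.-1] vertices, which gives [4 * q ^ L.-1 + 1]
    colours; [d <= 4 * k + 2] leaves at most [2 * k + 1] pairs in a facet. *)
Lemma chi_cf_FC_le (R : realType) (d k n e : nat) (L := (3 * k./2 + odd k)%N) :
  (1 < d < n)%N -> ~~ odd d -> (1 < k)%N -> (d <= 4 * k + 2)%N ->
  (n <= (2 ^ e.+1) ^ L)%N ->
  (chi_cf (FC R d n) <= 5 * (2 ^ e.+1) ^ L.-1)%N.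
Proof.
move=> dn deven k1 dk nL.
have h0 : (0 < k./2)%N by rewrite half_gt0.
have [F _ cardF] := @pPrimePowerField 2 e.+1 isT isT.
have cardU : #|{: unip F k./2 (odd k)}| = ((2 ^ e.+1) ^ L)%N.
  by rewrite !card_prod !card_mx cardF -!expnD; congr (_ ^ _)%N; rewrite /L; lia.
have cardP : #|{: point_coset F k./2 (odd k)}| = ((2 ^ e.+1) ^ L.-1)%N.
  by rewrite !card_prod !card_mx cardF -!expnD; congr (_ ^ _)%N; rewrite /L; lia.
have cardL : #|{: line_coset F k./2 (odd k)}| = ((2 ^ e.+1) ^ L.-1)%N.
  by rewrite !card_prod !card_mx cardF -!expnD; congr (_ ^ _)%N; rewrite /L; lia.
apply: leq_trans (@chi_cf_gale F k./2 (odd k) n _ h0 (leq_b1 _) _ _) _.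
- by rewrite cardU.
- move=> S /(FC_gale dn)[Sd Sgale]; rewrite Sd; split=> //.
  have kE : (k./2.*2 + odd k)%N = k by rewrite addnC odd_double_half.
  by rewrite kE; lia.
rewrite cardP cardL.
have : (0 < (2 ^ e.+1) ^ L.-1)%N by rewrite !expn_gt0.
lia.
Qed.

Lemma expr_le_powR (R : realType) (x y : R) (L : nat) : (0 < L)%N ->
  0 <= x -> x ^+ L <= y -> x ^+ L.-1 <= y `^ (1 - L%:R^-1).
Proof.
move=> L0 x0 xy; have L0' : (L%:R : R) != 0 by rewrite pnatr_eq0 -lt0n.
have E : (L.-1%:R : R) = L%:R * (1 - L%:R^-1).
  by rewrite mulrBr mulr1 mulfV // -{2}(prednK L0) -natr1 addrK.
rewrite -(powR_mulrn _ x0) E powRrM powR_mulrn //.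
apply: ge0_ler_powR; rewrite ?nnegrE ?exprn_ge0 //.
  by rewrite subr_ge0 invf_le1 ?ltr0n // ler1n.
by apply: le_trans xy; rewrite exprn_ge0.
Qed.

Local Open Scope classical_set_scope.
Local Open Scope ring_scope.
Unset Implicit Arguments.

Theorem theorem1p5 (R : realType) (d : nat) (hd : (16 <= d)%N)
    (hd_even : ~~ odd d) :
  let k := (d %/ 4)%N in
  let eps : R := if odd k then 0 else 1 in
  (fun n : nat => (chi_cf (FC R d n))%:R : R) =O_\oo
    (fun n : nat => n%:R `^ (1 - 2 / (3 * k%:R - 1 + eps)) : R).
Proof.
move=> k eps; pose L := (3 * k./2 + odd k)%N.
have k4 : (4 <= k)%N by rewrite /k leq_divRL.
have L0 : (0 < L)%N by rewrite /L; lia.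
have -> : 1 - 2 / (3 * k%:R - 1 + eps) = 1 - L%:R^-1 :> R.
  have -> : 3 * k%:R - 1 + eps = 2 * L%:R :> R.
    rewrite -[in LHS](odd_double_half k) -muln2 /eps /L.
    by case: (odd k) => /=; rewrite !natrD !natrM; ring.
  by rewrite invfM mulrA mulfV ?mul1r // pnatr_eq0.
apply/eqO_exP; exists (5 * 2 ^+ L.-1)%:R => //; first by rewrite ltr0n muln_gt0 expn_gt0.
near=> n.
have dn : (d < n)%N by near: n; exact: nbhs_infty_gt.
(* The field with [2 ^ e.+1] elements is large enough for [n], while [2 ^ e] is at most the [L]-th
   root of [n]; the gap costs the factor [2 ^ L.-1] in the constant. *)
pose e := trunc_log (2 ^ L) n.
have /andP[en ne] : ((2 ^ L) ^ e <= n < (2 ^ L) ^ e.+1)%N.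
  by apply: trunc_log_bounds; [rewrite -{1}(expn0 2) ltn_exp2l|exact: leq_ltn_trans dn].
have := @chi_cf_FC_le R d k n e; rewrite -/L => chi_le.
rewrite ger0_norm ?ler0n // ger0_norm ?powR_ge0 //.
apply: (@le_trans _ _ (5 * (2 ^ e.+1) ^ L.-1)%N%:R).
  rewrite ler_nat; apply: chi_le => //; [lia | exact: leq_trans k4 | |].
    by rewrite /k; lia.
  by rewrite ltnW // -expnM mulnC expnM.
have -> : (5 * (2 ^ e.+1) ^ L.-1)%N = (5 * 2 ^ L.-1 * (2 ^ e) ^ L.-1)%N.
  by rewrite expnS expnMn mulnA.
rewrite natrM; apply: ler_pM; rewrite ?ler0n //.
rewrite natrX; apply: expr_le_powR; rewrite ?ler0n //.
by rewrite -natrX ler_nat -expnM mulnC expnM.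
Unshelve. all: by end_near.
Qed.
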